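(* Let $\mathsf{L}$ be any of the logics $\mathsf{N}_\preccurlyeq$, $\mathsf{NN}_\preccurlyeq$, $\mathsf{NT}_\preccurlyeq$, $\mathsf{NW}_\preccurlyeq$, $\mathsf{NC}_\preccurlyeq$, $\mathsf{NU}_\preccurlyeq$, $\mathsf{NNU}_\preccurlyeq$, $\mathsf{NTU}_\preccurlyeq$, $\mathsf{NWU}_\preccurlyeq$, $\mathsf{NCU}_\preccurlyeq$, $\mathsf{NA}_\preccurlyeq$, $\mathsf{NNA}_\preccurlyeq$, $\mathsf{NTA}_\preccurlyeq$, $\mathsf{NWA}_\preccurlyeq$, $\mathsf{NCA}_\preccurlyeq$. For every formula $A$, if $A$ is valid in all $\mathsf{L}$-models, then $A$ is derivable in $\mathsf{L}$.
   Context: Language: formulas are given by $A ::= p \mid \bot \mid A\to A \mid A \preccurlyeq A$ with $p$ ranging over a countable set $Atm$ of propositional variables; $\top,\neg,\wedge,\vee$ are defined as usual from $\bot,\to$. A neighbourhood model is $\mathcal M=\langle W,N,V\rangle$ with $W\neq\emptyset$, $V:Atm\to\mathcal P(W)$, and $N:W\to\mathcal P(\mathcal P(W))$ such that $\emptyset\notin N(w)$ for all $w$. Forcing: $w\Vdash p$ iff $w\in V(p)$; $w\not\Vdash\bot$; $w\Vdash B\to C$ iff $w\Vdash B$ implies $w\Vdash C$; $w\Vdash B\preccurlyeq C$ iff for all $\alpha\in N(w)$, if some $v\in\alpha$ has $v\Vdash C$ then some $u\in\alpha$ has $u\Vdash B$. $A$ is valid in $\mathcal M$ if forced at every world, and valid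 in a class if valid in each model of the class. Model conditions (for all $w$): (N) $N(w)\neq\emptyset$; (T) there is $\alpha\in N(w)$ with $w\in\alpha$; (W) $N(w)\neq\emptyset$ and $w\in\alpha$ for all $\alpha\in N(w)$; (C) $\{w\}\in N(w)$ and $w\in\alpha$ for all $\alpha\in N(w)$; (U) if $\alpha\in N(w)$ and $v\in\alpha$ then $\bigcup N(v)=\bigcup N(w)$; (A) if $\alpha\in N(w)$ and $v\in\alpha$ then $N(v)=N(w)$. Axioms and rules: (cpr) from $A\to B$ infer $B\preccurlyeq A$; (tr) $(A\preccurlyeq B)\wedge(B\preccurlyeq C)\to(A\preccurlyeq C)$; (or) $(A\preccurlyeq B)\wedge(A\preccurlyeq C)\to(A\preccurlyeq B\vee C)$; (n) $\neg(\bot\preccurlyeq\top)$; (t) $(\bot\preccurlyeq A)\to\neg A$; (w) $A\to(A\preccurlyeq\top)$; (c) $(A\preccurlyeq\top)\to A$; (u$-$) $\neg(\bot\preccurlyeq A)\to(\bot\preccurlyeq(\bot\preccurlyeq A))$; (u) $(\bot\preccurlyeq A)\to(\bot\preccurlyeq\neg(\bot\preccurlyeq A))$; (a$-$) $(A\preccurlyeq B)\to(\bot\preccurlyeq\neg(A\preccurlyeq B))$; (a) $\neg(A\preccurlyeq B)\to(\bot\preccurlyeq(A\preccurlyeq B))$. Logics: $\mathsf{N}_\preccurlyeq$ = classical propositional logic (in this language) plus tr, or, cpr; $\mathsf{NN}_\preccurlyeq=\mathsf N_\preccurlyeq+$n; $\mathsf{NT}_\preccurlyeq=\mathsf N_\preccurlyeq+$t;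 $\mathsf{NW}_\preccurlyeq=\mathsf{NT}_\preccurlyeq+$w; $\mathsf{NC}_\preccurlyeq=\mathsf{NW}_\preccurlyeq+$c; for each such $\mathsf{L}$ (written $\mathsf{N}X_\preccurlyeq$), $\mathsf{N}XU_\preccurlyeq=\mathsf L+$u$-$,u and $\mathsf{N}XA_\preccurlyeq=\mathsf L+$a$-$,a. $A$ is derivable in $\mathsf L$ if there is a finite sequence ending in $A$ each element of which is an axiom of $\mathsf L$ or follows from earlier ones by modus ponens or cpr. An $\mathsf L$-model is a neighbourhood model satisfying the conditions named by the letters after the initial N in the name of $\mathsf L$ (e.g. $\mathsf{NTU}_\preccurlyeq$-models satisfy (T) and (U); $\mathsf N_\preccurlyeq$-models are all neighbourhood models). *)

(* Defs.v *)
From mathcomp Require Import all_boot.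
From mathcomp Require Import boolp classical_sets.
Set Implicit Arguments.
Unset Strict Implicit.
Unset Printing Implicit Defensive.
Local Open Scope classical_set_scope.

Inductive form (Atm : Type) : Type :=
| Var of Atm
| Bot
| Imp of form Atm & form Atm
| Preceq of form Atm & form Atm.
Arguments Bot {Atm}.

Declare Scope form_scope.
Delimit Scope form_scope with F.
Bind Scope form_scope with form.
Notation "⊥" := Bot : form_scope.
Notation "A ⊃ B" := (Imp A B) (at level 65, right associativity) : form_scope.
Notation "A ≼ B" := (Preceq A B) (at level 60, no associativity) : form_scope.
Notation "¬ A" := (Imp A Bot) (at level 35, right associativity) : form_scope.
Notation "⊤" := (Imp Bot Bot) : form_scope.

Definition And Atm (A B : form Atm) : form Atm := (¬ (A ⊃ ¬ B))%F.
Definition Or Atm (A B : form Atm) : form Atm := (¬ A ⊃ B)%F.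

Notation "A ∧ B" := (And A B) (at level 40, left associativity) : form_scope.
Notation "A ∨ B" := (Or A B) (at level 50, left associativity) : form_scope.

Record model (Atm : Type) := Model {
  world : Type;
  nbhd : world -> set (set world);
  valuation : Atm -> set world;
  world_nonempty : [set: world] !=set0;
  nbhd_set0 : forall w, ~ nbhd w set0
}.

Fixpoint forces Atm (M : model Atm) (w : world M) (A : form Atm) : Prop :=
  match A with
  | Var p => valuation p w
  | Bot => False
  | Imp B C => forces w B -> forces w C
  | Preceq B C => forall a, nbhd w a ->
      (exists2 v, a v & forces v C) -> exists2 u, a u & forces u B
  end.

Definition valid Atm (M : model Atm) (A : form Atm) : Prop :=
  forall w : world M, forces w A.

Section Conditions.
Context (Atm : Type) (M : model Atm).
Implicit Types (w v : world M) (a : set (world M)).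

Definition cond_N : Prop := forall w, nbhd w !=set0.
Definition cond_T : Prop := forall w, exists2 a, nbhd w a & a w.
Definition cond_W : Prop :=
  forall w, nbhd w !=set0 /\ forall a, nbhd w a -> a w.
Definition cond_C : Prop :=
  forall w, nbhd w [set w] /\ forall a, nbhd w a -> a w.
Definition cond_U : Prop := forall w a v, nbhd w a -> a v ->
  \bigcup_(b in nbhd v) b = \bigcup_(b in nbhd w) b.
Definition cond_A : Prop := forall w a v, nbhd w a -> a v -> nbhd v = nbhd w.

End Conditions.

Section Schemata.
Context (Atm : Type).
Implicit Types A B C : form Atm.
Local Open Scope form_scope.

(* A Hilbert-style axiomatisation, with modus ponens, of classical
   propositional logic over the primitive connectives ⊥ and ⊃. *)
Variant ax_cpl : set (form Atm) :=
| Ax_K A B : ax_cpl (A ⊃ B ⊃ A)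
| Ax_S A B C : ax_cpl ((A ⊃ B ⊃ C) ⊃ (A ⊃ B) ⊃ A ⊃ C)
| Ax_DN A : ax_cpl (¬ ¬ A ⊃ A).

Variant ax_tr : set (form Atm) :=
| Ax_tr A B C : ax_tr ((A ≼ B) ∧ (B ≼ C) ⊃ A ≼ C).
Variant ax_or : set (form Atm) :=
| Ax_or A B C : ax_or ((A ≼ B) ∧ (A ≼ C) ⊃ A ≼ (B ∨ C)).
Variant ax_n : set (form Atm) :=
| Ax_n : ax_n (¬ (⊥ ≼ ⊤)).
Variant ax_t : set (form Atm) :=
| Ax_t A : ax_t ((⊥ ≼ A) ⊃ ¬ A).
Variant ax_w : set (form Atm) :=
| Ax_w A : ax_w (A ⊃ (A ≼ ⊤)).
Variant ax_c : set (form Atm) :=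
| Ax_c A : ax_c ((A ≼ ⊤) ⊃ A).
Variant ax_um : set (form Atm) :=
| Ax_um A : ax_um (¬ (⊥ ≼ A) ⊃ (⊥ ≼ (⊥ ≼ A))).
Variant ax_u : set (form Atm) :=
| Ax_u A : ax_u ((⊥ ≼ A) ⊃ (⊥ ≼ ¬ (⊥ ≼ A))).
Variant ax_am : set (form Atm) :=
| Ax_am A B : ax_am ((A ≼ B) ⊃ (⊥ ≼ ¬ (A ≼ B))).
Variant ax_a : set (form Atm) :=
| Ax_a A B : ax_a (¬ (A ≼ B) ⊃ (⊥ ≼ (A ≼ B))).

Definition axioms_N : set (form Atm) := ax_cpl `|` ax_tr `|` ax_or.
Definition axioms_NN : set (form Atm) := axioms_N `|` ax_n.
Definition axioms_NT : set (form Atm) := axioms_N `|` ax_t.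
Definition axioms_NW : set (form Atm) := axioms_NT `|` ax_w.
Definition axioms_NC : set (form Atm) := axioms_NW `|` ax_c.

End Schemata.

(* A logic is named by a prefix N, NN, NT, NW or NC and a suffix (nothing, U
   or A). *)
Variant logic_prefix := PN | PNN | PNT | PNW | PNC.
Variant logic_suffix := S0 | SU | SA.
Definition logic : Type := logic_prefix * logic_suffix.

Definition axioms (Atm : Type) (L : logic) : set (form Atm) :=
  match L.1 with
  | PN => @axioms_N Atm
  | PNN => @axioms_NN Atm
  | PNT => @axioms_NT Atm
  | PNW => @axioms_NW Atm
  | PNC => @axioms_NC Atm
  end `|`
  match L.2 with
  | S0 => set0
  | SU => @ax_um Atm `|` @ax_u Atm
  | SA => @ax_am Atm `|` @ax_a Atm
  end.

Definition logic_model Atm (L : logic) (M : model Atm) : Prop :=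
  match L.1 with
  | PN => True
  | PNN => cond_N M
  | PNT => cond_T M
  | PNW => cond_W M
  | PNC => cond_C M
  end /\
  match L.2 with
  | S0 => True
  | SU => cond_U M
  | SA => cond_A M
  end.

Definition derivation Atm (L : logic) (s : seq (form Atm)) : Prop :=
  forall i, i < size s ->
  let D k := nth Bot s k in
  [\/ axioms L (D i),
      exists j k, [/\ j < i, k < i & D k = (D j ⊃ D i)%F] |
      exists j A B, [/\ j < i, D j = (A ⊃ B)%F & D i = (B ≼ A)%F]].

Definition derivable Atm (L : logic) (A : form Atm) : Prop :=
  exists s, derivation L (rcons s A).

(* Main.v *)
(** Completeness by canonical models whose worlds are the maximal consistent
    sets. For a world [w] and a formula [B], let [sphere w B] be the set of the
    worlds that omit every [E] with [B ≼ E] in [w]. By (tr) and (or) this set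
    refutes exactly the formulas [B ≼ C] that are not in [w], while respecting
    all the [D ≼ E] that are in [w]; moreover [sphere w ⊥] is the largest set of
    worlds respecting them. So the neighbourhoods of [w] can be taken to be all
    nonempty sets respecting the formulas [D ≼ E] of [w]; under (W) and (C) only
    those containing [w] are kept. Conditions (W) and (A) together force each
    world to have a single neighbourhood, and there [sphere w ⊥] alone is used. *)

Require Import Defs.
From mathcomp Require Import all_boot.
From mathcomp Require Import boolp classical_sets.

Set Implicit Arguments.
Unset Strict Implicit.
Unset Printing Implicit Defensive.
Local Open Scope classical_set_scope.

Section Completeness.
Context (Atm : Type) (L : logic).
Implicit Types (A B C D E : form Atm) (G : set (form Atm)).

(** * Hilbert-style derivability *)

Lemma derivation_cat (s t : seq (form Atm)) :
  derivation L s -> derivation L t -> derivation L (s ++ t).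
Proof.
move=> ds dt i; rewrite size_cat => lti /=; rewrite nth_cat.
case: (ltnP i (size s)) => [lt_is|le_si].
  case: (ds i lt_is) => [ax|[j [k [ltji ltki eqD]]]|[j [A [B [ltji eqj eqi]]]]].
  - by apply: Or31.
  - apply: Or32; exists j, k; split=> //.
    by rewrite !nth_cat (ltn_trans ltji lt_is) (ltn_trans ltki lt_is).
  - apply: Or33; exists j, A, B; split=> //.
    by rewrite nth_cat (ltn_trans ltji lt_is).
have lt_it : i - size s < size t by rewrite ltn_subLR.
have shift j : nth Bot (s ++ t) (size s + j) = nth Bot t j.
  by rewrite nth_cat ltnNge leq_addr /= addKn.
have lt_shift j : j < i - size s -> size s + j < i by rewrite ltn_subRL.
case: (dt _ lt_it) => [ax|[j [k [ltji ltki eqD]]]|[j [A [B [ltji eqj eqi]]]]].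
- by apply: Or31.
- apply: Or32; exists (size s + j), (size s + k).
  by rewrite !shift; split=> //; apply: lt_shift.
- apply: Or33; exists (size s + j), A, B.
  by rewrite shift; split=> //; apply: lt_shift.
Qed.

Lemma derivation_rcons (s : seq (form Atm)) A : derivation L s ->
  [\/ axioms L A,
      exists j k, [/\ j < size s, k < size s &
        nth Bot s k = (nth Bot s j ⊃ A)%F] |
      exists j B C, [/\ j < size s, nth Bot s j = (B ⊃ C)%F & A = (C ≼ B)%F]] ->
  derivation L (rcons s A).
Proof.
move=> ds step i; rewrite size_rcons ltnS leq_eqVlt => /predU1P[->|lt_is] /=;
  rewrite nth_rcons ?ltnn ?eqxx.
  case: step => [ax|[j [k [ltj ltk eqD]]]|[j [B [C [ltj eqj eqA]]]]].
  - by apply: Or31.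
  - by apply: Or32; exists j, k; rewrite !nth_rcons ltj ltk.
  - by apply: Or33; exists j, B, C; rewrite nth_rcons ltj.
rewrite lt_is.
case: (ds i lt_is) => [ax|[j [k [ltj ltk eqD]]]|[j [B [C [ltj eqj eqi]]]]].
- by apply: Or31.
- apply: Or32; exists j, k.
  by rewrite !nth_rcons (ltn_trans ltj lt_is) (ltn_trans ltk lt_is).
- by apply: Or33; exists j, B, C; rewrite nth_rcons (ltn_trans ltj lt_is).
Qed.

Lemma derivable_axiom A : axioms L A -> derivable L A.
Proof. by move=> axA; exists [::]; apply: (@derivation_rcons [::]) => //; apply: Or31. Qed.

Lemma derivable_mp A B : derivable L (A ⊃ B)%F -> derivable L A -> derivable L B.
Proof.
move=> [s ds] [t dt]; exists (rcons s (A ⊃ B)%F ++ rcons t A).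
apply: derivation_rcons; first exact: derivation_cat.
(* The premise [A] is the last entry of the second half, at index [(size s).+1 + size t], and the
   implication is the last entry of the first half, at index [size s]. *)
apply: Or32; exists ((size s).+1 + size t), (size s).
split.
- by rewrite size_cat !size_rcons ltn_add2l.
- by rewrite size_cat !size_rcons ltn_addr.
- rewrite !nth_cat !size_rcons ltnSn ltnNge leq_addr /= addKn.
  by rewrite !nth_rcons !ltnn !eqxx.
Qed.

Lemma derivable_cpr A B : derivable L (A ⊃ B)%F -> derivable L (B ≼ A)%F.
Proof.
move=> [s ds]; exists (rcons s (A ⊃ B)%F).
apply: derivation_rcons => //; apply: Or33; exists (size s), A, B.
by rewrite size_rcons nth_rcons ltnn eqxx.
Qed.

Lemma axioms_N_sub : @axioms_N Atm `<=` axioms L.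
Proof.
move=> A axA; rewrite /axioms; left.
case: L.1 => //; try by left.
- by left; left.
- by left; left; left.
Qed.

Lemma derivable_K A B : derivable L (A ⊃ B ⊃ A)%F.
Proof. by apply: derivable_axiom; apply: axioms_N_sub; left; left; constructor. Qed.

Lemma derivable_S A B C : derivable L ((A ⊃ B ⊃ C) ⊃ (A ⊃ B) ⊃ A ⊃ C)%F.
Proof. by apply: derivable_axiom; apply: axioms_N_sub; left; left; constructor. Qed.

Lemma derivable_DN A : derivable L (¬ ¬ A ⊃ A)%F.
Proof. by apply: derivable_axiom; apply: axioms_N_sub; left; left; constructor. Qed.

Lemma derivable_id A : derivable L (A ⊃ A)%F.
Proof.
apply: derivable_mp (derivable_K A A).
apply: derivable_mp (derivable_K A (A ⊃ A)%F); exact: derivable_S.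
Qed.

(** * Maximal consistent sets *)

(** The rule (cpr) acts only inside [derivable], never on hypotheses from [G]; this is what lets the
    deduction theorem go through. *)
Inductive entails G : set (form Atm) :=
| Entails_hyp A : G A -> entails G A
| Entails_thm A : derivable L A -> entails G A
| Entails_mp A B : entails G (A ⊃ B)%F -> entails G A -> entails G B.

Definition consistent G := ~ entails G Bot.

Definition mcs G := consistent G /\ forall A, G A \/ G (¬ A)%F.

Lemma entails_sub G (H : set (form Atm)) A :
  G `<=` H -> entails G A -> entails H A.
Proof.
move=> GH; elim=> {A} [A /GH|A|A B _ HAB _ HA].
- exact: Entails_hyp.
- exact: Entails_thm.
- exact: Entails_mp HAB HA.
Qed.

Lemma entails_deduction G A B : entails (G `|` [set A]) B -> entails G (A ⊃ B)%F.
Proof.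
elim=> {B} [B [GB|->]|B dB|B C _ HBC _ HB].
- by apply: Entails_mp (Entails_hyp GB); apply: Entails_thm; apply: derivable_K.
- by apply: Entails_thm; apply: derivable_id.
- by apply: Entails_thm; apply: derivable_mp dB; apply: derivable_K.
- apply: Entails_mp HB; apply: Entails_mp HBC.
  by apply: Entails_thm; apply: derivable_S.
Qed.

Lemma entails_set0 A : entails set0 A -> derivable L A.
Proof.
elim=> {A} [A []|A //|A B _ dAB _ dA]; exact: derivable_mp dAB dA.
Qed.

(** Finitely many hypotheses are used, and in a chain the largest set needed contains them all;
    [set0] is there for the case where none comes from [F]. *)
Lemma entails_chain G (F : set (set (form Atm))) A : total_on F subset ->
  entails (G `|` \bigcup_(X in F) X) A ->
  exists2 X, X = set0 \/ F X & entails (G `|` X) A.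
Proof.
move=> totF; elim=> {A} [A [GA|[X FX XA]]|A dA|A B _ [X FX HX] _ [Y FY HY]].
- by exists set0; [left|apply: Entails_hyp; left].
- by exists X; [right|apply: Entails_hyp; right].
- by exists set0; [left|apply: Entails_thm].
have [XY|YX] : X `<=` Y \/ Y `<=` X.
  case: FX => [->|FX]; first by left=> x [].
  case: FY => [->|FY]; first by right=> x [].
  exact: totF.
- exists Y => //; apply: Entails_mp HY; apply: entails_sub HX.
  exact: setUS.
- exists X => //; apply: Entails_mp HX _; apply: entails_sub HY.
  exact: setUS.
Qed.

Lemma lindenbaum G : consistent G -> exists2 w, mcs w & G `<=` w.
Proof.
move=> conG.
(* Zorn runs over the [X] whose union with [G] is consistent, not over supersets of [G], so that the
   union of the empty chain qualifies. *)
have [F FP totF|M [conM maxM]] :=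
    @Zorn_bigcup _ [set X | consistent (G `|` X)].
  move=> /(entails_chain totF)[X [->|/FP conX //]].
  by rewrite setU0.
exists (G `|` M); last by left.
split=> // A.
(* Adding an absent [B] to [M] is inconsistent by maximality, so its negation is entailed. *)
have omit B : ~ (G `|` M) B -> entails (G `|` M) (¬ B)%F.
  move=> nB; apply: entails_deduction; rewrite -setUA.
  apply: contrapT; apply: maxM; split; first by left.
  by move=> /(_ B) MB; apply: nB; right; apply: MB; right.
apply: contrapT => /not_orP[/omit nA /omit nnA].
exact: conM (Entails_mp nnA nA).
Qed.

Lemma mcs_entails w A : mcs w -> entails w A -> w A.
Proof.
move=> [conw maxw] HA; case: (maxw A) => // nA; case: conw.
exact: Entails_mp (Entails_hyp nA) HA.
Qed.

Lemma mcs_derivable w A : mcs w -> derivable L A -> w A.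
Proof. by move=> mw dA; apply: mcs_entails => //; apply: Entails_thm. Qed.

Lemma mcs_bot w : mcs w -> ~ w Bot.
Proof. by move=> [conw _] /Entails_hyp. Qed.

Lemma mcs_imp w A B : mcs w -> w (A ⊃ B)%F <-> (w A -> w B).
Proof.
move=> mw; split=> [wAB wA|wAB].
  by apply: mcs_entails => //; apply: Entails_mp (Entails_hyp wAB) (Entails_hyp wA).
case: (mw.2 A) => [/wAB wB|wnA]; apply: mcs_entails => //; apply: entails_deduction.
  by apply: Entails_hyp; left.
apply: Entails_mp (Entails_thm _ (derivable_DN B)) _.
apply: entails_deduction; apply: (@Entails_mp _ A); apply: Entails_hyp.
  by left; left.
by left; right.
Qed.

Lemma mcs_axiom w A B : mcs w -> axioms L (A ⊃ B)%F -> w A -> w B.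
Proof.
move=> mw /derivable_axiom dAB; apply/mcs_imp => //; exact: mcs_derivable.
Qed.

Lemma mcs_neg w A : mcs w -> w (¬ A)%F <-> ~ w A.
Proof.
move=> mw; split=> [/mcs_imp wA /(wA mw)|nwA]; first exact: mcs_bot.
by apply/mcs_imp.
Qed.

Lemma mcs_and w A B : mcs w -> w (A ∧ B)%F <-> w A /\ w B.
Proof.
move=> mw; rewrite /And mcs_neg // mcs_imp // mcs_neg //.
by split=> [/not_implyP[wA /contrapT wB]|[wA wB] /(_ wA)].
Qed.

Lemma mcs_or w A B : mcs w -> w (A ∨ B)%F <-> w A \/ w B.
Proof.
move=> mw; rewrite /Or mcs_imp // mcs_neg //.
by case: (pselect (w A)); tauto.
Qed.

(** This replaces propositional derivations by checks on maximal consistent sets, in particular for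
    the premise of (cpr). *)
Lemma derivable_mcs A : (forall w, mcs w -> w A) -> derivable L A.
Proof.
move=> allA; apply: contrapT => ndA.
have [|w mw wnA] := @lindenbaum [set (¬ A)%F].
  move=> incon; apply: ndA; apply: derivable_mp (derivable_DN A) _.
  by apply: entails_set0; apply: entails_deduction; rewrite set0U.
by apply: (mcs_neg A mw).1 (allA w mw); apply: wnA.
Qed.

Lemma mcs_cpr w A B : mcs w -> (forall v, mcs v -> v A -> v B) -> w (B ≼ A)%F.
Proof.
move=> mw AB; apply: mcs_derivable => //; apply: derivable_cpr.
by apply: derivable_mcs => v mv; apply/mcs_imp => //; apply: AB.
Qed.

Lemma mcs_tr w A B C : mcs w -> w (A ≼ B)%F -> w (B ≼ C)%F -> w (A ≼ C)%F.
Proof.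
move=> mw wAB wBC.
apply: (@mcs_axiom _ ((A ≼ B) ∧ (B ≼ C))%F) => //; last exact/mcs_and.
by apply: axioms_N_sub; left; right.
Qed.

Lemma mcs_preceq_or w A B C :
  mcs w -> w (A ≼ B)%F -> w (A ≼ C)%F -> w (A ≼ (B ∨ C))%F.
Proof.
move=> mw wAB wAC.
apply: (@mcs_axiom _ ((A ≼ B) ∧ (A ≼ C))%F) => //; last exact/mcs_and.
by apply: axioms_N_sub; right.
Qed.

Lemma mcs_preceq_bot w A : mcs w -> w (A ≼ ⊥)%F.
Proof. by move=> mw; apply: mcs_cpr => // v /mcs_bot. Qed.

(* Since [P] is closed under disjunction, finitely many hypotheses can be merged
   into one. *)
Lemma entails_negs (P : set (form Atm)) D : P Bot ->
  (forall A B, P A -> P B -> P (A ∨ B)%F) ->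
  entails [set (¬ E)%F | E in P] D ->
  exists2 E, P E & forall v, mcs v -> ~ v E -> v D.
Proof.
move=> P0 PU; elim=> {D} [D [E PE <-]|D dD|D D' _ [E PE HE] _ [E' PE' HE']].
- by exists E => // v mv; rewrite mcs_neg.
- by exists Bot => // v mv _; apply: mcs_derivable.
exists (E ∨ E')%F; first exact: PU.
move=> v mv; rewrite mcs_or // => /not_orP[nE nE'].
by apply: (mcs_imp D D' mv).1 (HE v mv nE) (HE' v mv nE').
Qed.

(** * Canonical models *)

Definition cworld := {w : set (form Atm) | mcs w}.
Local Notation "w ∋ A" := (sval w A%F) (at level 70).
Implicit Types (w v u : cworld) (a : set cworld).

Definition sphere w B : set cworld := [set v | forall E, w ∋ B ≼ E -> ~ v ∋ E].

(** This is the forcing clause of [≼] with membership in place of forcing. *)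
Definition respects w a := forall D E, w ∋ D ≼ E ->
  (exists2 v, a v & v ∋ E) -> exists2 u, a u & u ∋ D.

Lemma sphere_omits w B v : sphere w B v -> ~ v ∋ B.
Proof. by apply; apply: mcs_cpr => //; exact: (svalP w). Qed.

(** Otherwise the negations of the [E] with [B ≼ E] in [w] entail [¬ C]. By (or) a single such [E]
    suffices, so [C] implies [E]; then (cpr) gives [E ≼ C] and (tr) gives [B ≼ C]. *)
Lemma sphere_meets w B C : ~ w ∋ B ≼ C -> exists2 v, sphere w B v & v ∋ C.
Proof.
have mw := svalP w; move=> nBC.
set G := [set (¬ E)%F | E in [set E | w ∋ B ≼ E]].
have [|v mv Gv] := @lindenbaum (G `|` [set C]).
  move=> /entails_deduction incon.
  have [|A A'|E /= BE negE] := entails_negs _ _ incon.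
  - exact: mcs_preceq_bot.
  - exact: mcs_preceq_or.
  - apply: nBC; apply: mcs_tr BE _ => //; apply: mcs_cpr => // v mv vC.
    by apply: contrapT => /(negE v mv) /mcs_neg; apply.
exists (exist _ v mv); last by apply: Gv; right.
move=> E BE /=; apply/mcs_neg => //.
by apply: Gv; left; exists E.
Qed.

(** If [B ≼ D] were in [w], (tr) would put [B ≼ E] there and exclude [E] from the sphere; so
    [sphere_meets] applies to [B] and [D]. *)
Lemma sphere_respects w B : respects w (sphere w B).
Proof.
move=> D E DE [v BEv vE]; apply: sphere_meets => BD.
by apply: BEv vE; apply: mcs_tr BD DE; exact: (svalP w).
Qed.

Lemma respects_sub w a : respects w a -> a `<=` sphere w Bot.
Proof.
move=> resp v av E wE vE; have [|u _] := resp _ _ wE; first by exists v.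
exact: mcs_bot (svalP u).
Qed.

Section CanonicalModel.
Context (N : cworld -> set (set cworld)) (w0 : cworld).
Hypothesis N_set0 : forall w, ~ N w set0.

Definition canonical_model : model Atm :=
  @Model Atm cworld N (fun p => [set w | w ∋ Var p]) (ex_intro _ w0 I) N_set0.

(** With [N] abstract, one truth lemma serves every choice of neighbourhoods. The first hypothesis
    yields that members of [w] are forced in the case of [≼], the second the converse. *)
Lemma canonical_truth :
  (forall w a, N w a -> respects w a) ->
  (forall w B C, ~ w ∋ B ≼ C -> exists2 a, N w a &
     (exists2 v, a v & v ∋ C) /\ forall u, a u -> ~ u ∋ B) ->
  forall A (w : world canonical_model), forces w A <-> w ∋ A.
Proof.
move=> respN sepN; elim=> [p|||] //.
- by move=> w; split=> // /(mcs_bot (svalP w)).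
- by move=> B IHB C IHC w; rewrite (mcs_imp _ _ (svalP w)) -IHB -IHC.
move=> B IHB C IHC w; split=> [fBC|wBC a Na [v av /IHC vC]].
  apply: contrapT => /sepN[a Na [[v av vC] aB]].
  have [|u au /IHB] := fBC a Na; first by exists v => //; apply/IHC.
  exact: aB.
have [|u au uB] := respN w a Na B C wBC; first by exists v.
by exists u => //; apply/IHB.
Qed.

End CanonicalModel.

Definition nbhd_respecting w : set (set cworld) :=
  [set a | a !=set0 /\ respects w a].
Definition nbhd_centered w : set (set cworld) :=
  [set a | a w /\ respects w a].
Definition nbhd_single w : set (set cworld) := [set sphere w Bot].

Lemma nbhd_respecting_sep w B C : ~ w ∋ B ≼ C ->
  exists2 a, nbhd_respecting w a &
    (exists2 v, a v & v ∋ C) /\ forall u, a u -> ~ u ∋ B.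
Proof.
move=> /sphere_meets[v vS vC]; exists (sphere w B).
  by split; [exists v|exact: sphere_respects].
by split; [exists v|exact: sphere_omits].
Qed.

(** Condition (U) thereby reduces to agreement on the formulas [⊥ ≼ E], which determine
    [sphere w Bot]. *)
Lemma bigcup_nbhd_respecting w :
  \bigcup_(a in nbhd_respecting w) a = sphere w Bot.
Proof.
apply/seteqP; split=> [v [a [_ /respects_sub]]|v wv]; first exact.
by exists (sphere w Bot) => //; split; [exists v|exact: sphere_respects].
Qed.

(** * Axioms and model conditions *)

Lemma sphere_nonempty w : L.1 = PNN -> sphere w Bot !=set0.
Proof.
move=> eqL; have [|v vS _] := @sphere_meets w Bot (⊤)%F; last by exists v.
apply/mcs_neg; first exact: (svalP w).
apply: mcs_derivable (svalP w) _; apply: derivable_axiom.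
by rewrite /axioms eqL; left; right.
Qed.

Definition has_t (p : logic_prefix) :=
  match p with PNT | PNW | PNC => true | _ => false end.
Definition has_w (p : logic_prefix) :=
  match p with PNW | PNC => true | _ => false end.

Lemma sphere_refl w : has_t L.1 -> sphere w Bot w.
Proof.
have mw := svalP w; move=> hasL E wE; apply/mcs_neg => //.
apply: mcs_axiom wE => //; rewrite /axioms; left.
by case: L.1 hasL => // _; [right|left; right|left; left; right].
Qed.

Lemma has_w_t p : has_w p -> has_t p.
Proof. by case: p. Qed.

Lemma mcs_w w A : has_w L.1 -> w ∋ A -> w ∋ A ≼ ⊤.
Proof.
have mw := svalP w; move=> hasL wA.
apply: mcs_axiom wA => //; rewrite /axioms; left.
by case: L.1 hasL => // _; [right|left; right].
Qed.

Lemma mcs_c w A : L.1 = PNC -> w ∋ A ≼ ⊤ -> w ∋ A.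
Proof.
have mw := svalP w; move=> eqL wA.
apply: mcs_axiom wA => //.
by rewrite /axioms eqL; left; right.
Qed.

Lemma preceq_top w A B : w ∋ A ≼ ⊤ -> w ∋ A ≼ B.
Proof.
have mw := svalP w; move=> wA; apply: mcs_tr wA _ => //.
by apply: mcs_cpr => // v mv _; apply/mcs_imp.
Qed.

(** If [w] contained some [E] with [B ≼ E], (w) would give [E ≼ ⊤], hence [B ≼ ⊤] and [B ≼ C] by
    (tr). *)
Lemma sphere_center w B C : has_w L.1 -> ~ w ∋ B ≼ C -> sphere w B w.
Proof.
move=> hasL nBC E BE /(mcs_w hasL) wE; apply: nBC; apply: preceq_top.
by apply: mcs_tr BE wE; exact: (svalP w).
Qed.

(** Worlds of [sphere w Bot] omit whatever [w] declares impossible: by (u) this is [¬ (⊥ ≼ A)] when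
    [⊥ ≼ A] is in [w], and by (u-) it is [⊥ ≼ A] itself otherwise. *)
Lemma sphere_same_bot w v A : L.2 = SU -> sphere w Bot v ->
  w ∋ ⊥ ≼ A <-> v ∋ ⊥ ≼ A.
Proof.
have [mw mv] := (svalP w, svalP v); move=> eqL wv.
split=> [wA|vA]; apply: contrapT => nA.
- apply: (wv (¬ (⊥ ≼ A))%F); last exact/mcs_neg.
  apply: mcs_axiom wA => //.
  by rewrite /axioms eqL; right; right.
- apply: (wv (⊥ ≼ A)%F) => //.
  apply: (@mcs_axiom _ (¬ (⊥ ≼ A))%F) => //; last exact/mcs_neg.
  by rewrite /axioms eqL; right; left.
Qed.

(** The same argument, with (a-) and (a) for (u) and (u-). *)
Lemma sphere_same_preceq w v A B : L.2 = SA -> sphere w Bot v ->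
  w ∋ A ≼ B <-> v ∋ A ≼ B.
Proof.
have [mw mv] := (svalP w, svalP v); move=> eqL wv.
split=> [wA|vA]; apply: contrapT => nA.
- apply: (wv (¬ (A ≼ B))%F); last exact/mcs_neg.
  apply: mcs_axiom wA => //.
  by rewrite /axioms eqL; right; left.
- apply: (wv (A ≼ B)%F) => //.
  apply: (@mcs_axiom _ (¬ (A ≼ B))%F) => //; last exact/mcs_neg.
  by rewrite /axioms eqL; right; right.
Qed.

Lemma sphere_bot_eq w v : (forall A, w ∋ ⊥ ≼ A <-> v ∋ ⊥ ≼ A) ->
  sphere v Bot = sphere w Bot.
Proof. by move=> vw; apply/seteqP; split=> u uS E /vw; apply: uS. Qed.

Lemma respects_eq w v a : (forall A B, w ∋ A ≼ B <-> v ∋ A ≼ B) ->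
  respects v a <-> respects w a.
Proof. by move=> vw; split=> resp D E /vw; apply: resp. Qed.

Lemma bigcup_nbhd_centered w : has_w L.1 ->
  \bigcup_(a in nbhd_centered w) a = sphere w Bot.
Proof.
move=> hasL; apply/seteqP; split=> [v [a [_ /respects_sub]]|v wv]; first exact.
exists (sphere w Bot) => //; split; last exact: sphere_respects.
by apply: sphere_refl; apply: has_w_t.
Qed.

Lemma nbhd_centered_sep w B C : has_w L.1 -> ~ w ∋ B ≼ C ->
  exists2 a, nbhd_centered w a &
    (exists2 v, a v & v ∋ C) /\ forall u, a u -> ~ u ∋ B.
Proof.
move=> hasL nBC; exists (sphere w B).
  by split; [exact: sphere_center nBC|exact: sphere_respects].
by split; [exact: sphere_meets|exact: sphere_omits].
Qed.

(** One neighbourhood refutes every missing [B ≼ C]: a world of it containing [B] contains [B ≼ ⊤]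
    by (w), and so does [w], since the two agree on [≼]; then [B ≼ C] is in [w]. *)
Lemma nbhd_single_sep w B C : has_w L.1 -> L.2 = SA -> ~ w ∋ B ≼ C ->
  exists2 a, nbhd_single w a &
    (exists2 v, a v & v ∋ C) /\ forall u, a u -> ~ u ∋ B.
Proof.
have mw := svalP w; move=> hasL eqL nBC; exists (sphere w Bot) => //; split.
  by apply: sphere_meets => wC; apply: nBC; apply: mcs_tr wC => //; apply: mcs_preceq_bot.
move=> u wu /(mcs_w hasL) /(sphere_same_preceq _ _ eqL wu) wB.
exact: nBC (preceq_top _ wB).
Qed.

(** If [A] is in a world [v] of the sphere, (w) puts [A ≼ ⊤] in [v], agreement on [≼] moves it to
    [w], and (c) returns [A] in [w]. Inclusion between maximal consistent sets is equality. *)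
Lemma sphere_bot_singleton w : L.1 = PNC -> L.2 = SA -> sphere w Bot = [set w].
Proof.
move=> eqP eqS; have hasw : has_w L.1 by rewrite eqP.
have sub v : sphere w Bot v -> sval v `<=` sval w.
  move=> wv A /(mcs_w hasw) /(sphere_same_preceq _ _ eqS wv); exact: mcs_c.
apply/seteqP; split=> [v wv|_ ->]; last by apply: sphere_refl; rewrite eqP.
apply: eq_sig_hprop => [X|]; first exact: Prop_irrelevance.
apply/seteqP; split; first exact: sub.
move=> A wA; have [//|vnA] := (svalP v).2 A.
by have /mcs_neg/(_ wA) := sub v wv _ vnA; case; exact: (svalP w).
Qed.

(** * Completeness, by cases on the logic *)

Lemma completeness_of_nbhd (N : cworld -> set (set cworld)) A :
  (forall w a, N w a -> a !=set0 /\ respects w a) ->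
  (forall w B C, ~ w ∋ B ≼ C -> exists2 a, N w a &
     (exists2 v, a v & v ∋ C) /\ forall u, a u -> ~ u ∋ B) ->
  (forall w0 N0, logic_model L (@canonical_model N w0 N0)) ->
  (forall M : model Atm, logic_model L M -> valid M A) -> derivable L A.
Proof.
move=> respN sepN LN validA; apply: derivable_mcs => w mw.
have N0 v : ~ N v set0 by move=> /respN[[]].
(* The world that makes the model nonempty is the one where [A] is to be checked. *)
pose w0 : cworld := exist _ w mw.
apply: ((@canonical_truth N w0 N0 _ sepN A w0).1 (validA _ (LN w0 N0) w0)).
by move=> v a /respN[].
Qed.

Lemma canonical_cond_A_respecting w0 N0 :
  L.2 = SA -> cond_A (@canonical_model nbhd_respecting w0 N0).
Proof.
move=> eqL w a v [_ /respects_sub asub] /asub wv; apply/seteqP.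
have resp b := @respects_eq w v b (fun A B => sphere_same_preceq A B eqL wv).
by split=> b [b0 /resp].
Qed.

Lemma completeness A :
  (forall M : model Atm, logic_model L M -> valid M A) -> derivable L A.
Proof.
(* First the prefixes N, NN and NT, where all nonempty respecting sets are neighbourhoods. *)
case hasw : (has_w L.1); last first.
  apply: (@completeness_of_nbhd nbhd_respecting) => //.
    exact: nbhd_respecting_sep.
  move=> w0 N0; split.
    case eqP : L.1 => //; try by rewrite eqP in hasw.
    - move=> w; exists (sphere w Bot); split; last exact: sphere_respects.
      exact: sphere_nonempty.
    - move=> w; have wS : sphere w Bot w by apply: sphere_refl; rewrite eqP.
      by exists (sphere w Bot) => //; split; [exists w|exact: sphere_respects].
  case eqS : L.2 => //; last exact: canonical_cond_A_respecting.
  move=> w a v [_ /respects_sub asub] /asub wv.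
  rewrite /= !bigcup_nbhd_respecting; apply: sphere_bot_eq => B.
  exact: sphere_same_bot.
have refl w : sphere w Bot w by apply: sphere_refl; apply: has_w_t.
(* With (w), the suffix A calls for the single sphere; the other suffixes use the respecting sets
   that contain [w]. *)
have [eqS|neS] := pselect (L.2 = SA).
  apply: (@completeness_of_nbhd nbhd_single) => //.
  - by move=> w _ ->; split; [exists w|exact: sphere_respects].
  - by move=> w B C; apply: nbhd_single_sep.
  move=> w0 N0; split; rewrite ?eqS.
    case eqP : L.1 => //; try by rewrite eqP in hasw.
    - by move=> w; split=> [|a ->]; [exists (sphere w Bot)|exact: refl].
    - move=> w; split=> [|a ->]; last exact: refl.
      by rewrite /= /nbhd_single sphere_bot_singleton.
  move=> w a v -> wv; rewrite /= /nbhd_single.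
  congr [set _]; apply: sphere_bot_eq => B; exact: sphere_same_preceq.
apply: (@completeness_of_nbhd nbhd_centered) => //.
- by move=> w a [aw resp]; split=> //; exists w.
- by move=> w B C; apply: nbhd_centered_sep.
move=> w0 N0; split.
  case eqP : L.1 => //; try by rewrite eqP in hasw.
  - move=> w; split=> [|a []] //; exists (sphere w Bot).
    by split=> //; exact: sphere_respects.
  (* The singleton of [w] respects [w]: from [E] in [w], (w) gives [E ≼ ⊤], (tr) gives [D ≼ ⊤], and
     (c) gives [D]. *)
  - move=> w; split=> [|a []] //; split=> // D E DE [_ -> wE]; exists w => //.
    apply: mcs_c => //; apply: mcs_tr DE _; first exact: (svalP w).
    exact: mcs_w.
case eqS : L.2 => // w a v [_ /respects_sub asub] /asub wv.
rewrite /= !bigcup_nbhd_centered //; apply: sphere_bot_eq => B.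
exact: sphere_same_bot.
Qed.

End Completeness.

Theorem theorem3p9 (Atm : countType) (L : logic) (A : form Atm) :
  (forall M : model Atm, logic_model L M -> valid M A) -> derivable L A.
Proof. exact: completeness. Qed.
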